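(* Let $\alpha,\beta\in\mathbb{R}$ with $\alpha\neq0$, $\beta\neq0$, $\alpha+\beta\ne 0$, let $p$ and $q_t=\mathrm{softmax}(f^t)$ be strictly positive probability distributions on $\{1,\dots,C\}$, and let $\eta>0$. Let $\mathsf{LogR}^{(\alpha,\beta)}_t$ and $\mathsf{N}^{(\alpha,\beta)}_t$ be the log mass ratio and normalization factor of one gradient descent step on the logits with learning rate $\eta$ for the loss $\mathbb{D}^{(\alpha,\beta)}_{\mathrm{AB}}(p\|q)$. Then for every class $y$: $$\big|\mathsf{LogR}^{(\alpha,\beta)}_t(y)\big|\le \eta\, q_t(y)^{\beta}\left|\frac{p(y)^\alpha-q_t(y)^\alpha}{\alpha}\right|+\eta\, q_t(y)\sum_k q_t(k)^{\beta}\left|\frac{p(k)^\alpha-q_t(k)^\alpha}{\alpha}\right|+\big|\mathsf{N}^{(\alpha,\beta)}_t(y)\big|,$$ where $\mathsf{N}^{(\alpha,\beta)}_t(y)$ is independent of $y$ and vanishes when $p=q_t$.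
   Context: For $\alpha,\beta,\alpha+\beta\ne0$ the $\alpha$-$\beta$-divergence of two discrete distributions on $C$ classes is $$\mathbb{D}_{\mathrm{AB}}^{(\alpha,\beta)}(p\|q)=-\frac{1}{\alpha\beta}\sum_{k}\Big[p(k)^\alpha q(k)^\beta-\frac{\alpha}{\alpha+\beta}p(k)^{\alpha+\beta}-\frac{\beta}{\alpha+\beta}q(k)^{\alpha+\beta}\Big].$$ The student distribution at step $t$ is $q_t(y)=\exp(f^t_y)/\sum_k\exp(f^t_k)$ for a logit vector $f^t\in\mathbb{R}^C$. For a loss $\ell$, viewed as a function of the logits $f$ through $q=\mathrm{softmax}(f)$, one gradient descent step with learning rate $\eta$ is $f^{t+1}_y=f^t_y-\eta\,\nabla_{f^t_y}\ell$, where $\nabla_{f^t_y}\ell$ is the partial derivative of $\ell$ with respect to $f_y$ at $f^t$, and $q_{t+1}=\mathrm{softmax}(f^{t+1})$. The log mass ratio is $\mathsf{LogR}_t(y)=\log\big(q_{t+1}(y)/q_t(y)\big)$, and the normalization factor is defined by $\mathsf{LogR}_t(y)=-\eta\,\nabla_{f^t_y}\ell+\mathsf{N}_t(y)$. *)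

(* Defs.v *)
From HB Require Import structures.
From mathcomp Require Import all_boot all_order all_algebra.
From mathcomp Require Import all_classical all_reals all_analysis.

Set Implicit Arguments.
Unset Strict Implicit.
Unset Printing Implicit Defensive.

Import Order.TTheory GRing.Theory Num.Theory.
Import numFieldNormedType.Exports.

Local Open Scope ring_scope.

(* Logit vectors and distributions on C classes are row vectors; the classes
   1, ..., C are the elements of 'I_C. *)

Definition AB_divergence (R : realType) (C : nat) (alpha beta : R)
    (p q : 'rV[R]_C) : R :=
  - (1 / (alpha * beta)) *
    \sum_(k < C) (p 0 k `^ alpha * q 0 k `^ beta
                  - alpha / (alpha + beta) * p 0 k `^ (alpha + beta)
                  - beta / (alpha + beta) * q 0 k `^ (alpha + beta)).

Definition softmax (R : realType) (C : nat) (f : 'rV[R]_C) : 'rV[R]_C :=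
  \row_(y < C) (expR (f 0 y) / \sum_(k < C) expR (f 0 k)).

(* 'D_v is total; it is the directional derivative wherever the limit of the
   difference quotient exists. *)
Definition partial (R : realType) (C : nat) (l : 'rV[R]_C -> R)
    (f : 'rV[R]_C) (y : 'I_C) : R :=
  'D_(delta_mx 0 y) l f.

Definition gd_step (R : realType) (C : nat) (eta : R) (l : 'rV[R]_C -> R)
    (f : 'rV[R]_C) : 'rV[R]_C :=
  \row_(y < C) (f 0 y - eta * partial l f y).

Definition LogR (R : realType) (C : nat) (eta : R) (l : 'rV[R]_C -> R)
    (f : 'rV[R]_C) (y : 'I_C) : R :=
  ln (softmax (gd_step eta l f) 0 y / softmax f 0 y).

(* The solution N of  LogR y = - eta * partial l f y + N y. *)
Definition normalization (R : realType) (C : nat) (eta : R)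
    (l : 'rV[R]_C -> R) (f : 'rV[R]_C) (y : 'I_C) : R :=
  LogR eta l f y + eta * partial l f y.

Definition AB_loss (R : realType) (C : nat) (alpha beta : R)
    (p f : 'rV[R]_C) : R :=
  AB_divergence alpha beta p (softmax f).

(* Main.v *)
(* On the line h |-> f + h e_y each power q_k ^ b is the exponential of
   b (f_k + h [k = y] - ln Z(h)), with Z the partition function, so the gradient
   of the loss is
     q_y \sum_k g_k - g_y,  where  g_k = q_k ^ beta (p_k ^ alpha - q_k ^ alpha) / alpha.
   Moreover LogR y = - eta * gradient + ln (Z_t / Z_(t+1)), so the normalization
   is ln (Z_t / Z_(t+1)); the bound is the triangle inequality, and for p = q the
   gradient is zero and the step does not move f. *)
Require Import Defs.
From mathcomp Require Import all_boot all_order all_algebra.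
From mathcomp Require Import all_classical all_reals all_analysis.
From mathcomp Require Import ring.
Import Order.TTheory GRing.Theory Num.Theory.
Import numFieldNormedType.Exports.
Local Open Scope ring_scope.

(** The two difference quotients agree for every [h], so no differentiability of [l] is needed;
    partial derivatives become one-variable derivatives, to which the chain rule for [expR] and [ln]
    applies. *)
Lemma derive_line (R : realType) (V W : normedModType R) (l : V -> W) (x v : V) :
  'D_v l x = 'D_1 (fun h : R => l (h *: v + x)) 0.
Proof.
rewrite /derive [in RHS](_ : (fun h => _) =
    (fun h => h^-1 *: ((l \o shift x) (h *: v) - l x))) //.
by apply/funext => h /=; rewrite addr0 scale0r add0r [h *: 1]mulr1.
Qed.

Section Softmax.
Context {R : realType} {C : nat}.
Implicit Types (f : 'rV[R]_C) (y k : 'I_C).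

(** The class [y] witnesses that the sum is nonempty; for [C = 0] it would be 0. *)
Lemma sum_expR_gt0 f y : 0 < \sum_k expR (f 0 k).
Proof.
rewrite (bigD1 y) //=; apply: ltr_wpDr; last exact: expR_gt0.
by apply: sumr_ge0 => k _; exact: expR_ge0.
Qed.

Lemma softmaxE f y :
  softmax f 0 y = expR (f 0 y - ln (\sum_k expR (f 0 k))).
Proof. by rewrite mxE expRB lnK // posrE (sum_expR_gt0 f y). Qed.

Lemma softmax_gt0 f y : 0 < softmax f 0 y.
Proof. by rewrite softmaxE expR_gt0. Qed.

(** The function is the logarithm of the [k]-th softmax weight along the line: the logit contributes
    the indicator of [k == y], and the log-partition function contributes Z'/Z, which is the softmax
    weight of [y]. *)
Lemma is_derive_log_softmax f y k :
  is_derive (0 : R) 1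
    (fun h : R => (h *: delta_mx 0 y + f) 0 k
       - ln (\sum_j expR ((h *: delta_mx 0 y + f) 0 j)))
    ((k == y)%:R - softmax f 0 y).
Proof.
have coordE j (h : R) : (h *: delta_mx 0 y + f) 0 j = (j == y)%:R * h + f 0 j.
  by rewrite !mxE /= mulrC.
have dcoord j : is_derive (0 : R) 1
    (fun h : R => (h *: delta_mx 0 y + f) 0 j) ((j == y)%:R : R).
  rewrite (_ : (fun _ => _) = (j == y)%:R \*: id + cst (f 0 j)); last first.
    by apply/funext => h; rewrite coordE.
  by apply: is_derive_eq; rewrite addr0 [_ *: 1]mulr1.
apply: is_deriveB.
rewrite (_ : (fun _ => _) = @ln R \o
    (\sum_j (@expR R \o fun h : R => (h *: delta_mx 0 y + f) 0 j))); last first.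
  by apply/funext => h /=; rewrite fct_sumE.
have S0 : (\sum_j (@expR R \o fun h : R => (h *: delta_mx 0 y + f) 0 j)) 0
    = \sum_k expR (f 0 k).
  by rewrite fct_sumE; apply: eq_bigr => j _ /=; rewrite coordE mulr0 add0r.
apply: is_derive_eq.
  apply: is_derive1_comp; apply: is_derive1_ln.
  by rewrite S0 (sum_expR_gt0 f y).
(* Only the term [j = y] of the partition function varies along the line. *)
rewrite S0 [X in _ * X](bigD1 y) //= [X in _ + X]big1 => [|j /negPf jy].
  by rewrite eqxx mulr1 addr0 coordE mulr0 add0r mxE mulrC.
by rewrite jy mulr0.
Qed.

(** The exponent is left arbitrary because the loss involves both [beta] and [alpha + beta]. *)
Lemma is_derive_softmax_powR f y k (b : R) :
  is_derive (0 : R) 1 (fun h : R => softmax (h *: delta_mx 0 y + f) 0 k `^ b)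
    (b * softmax f 0 k `^ b * ((k == y)%:R - softmax f 0 y)).
Proof.
have du := is_derive_log_softmax f y k.
rewrite (_ : (fun _ => _) = @expR R \o (b \*: (fun h : R =>
    (h *: delta_mx 0 y + f) 0 k
       - ln (\sum_j expR ((h *: delta_mx 0 y + f) 0 j))))); last first.
  by apply/funext => h /=; rewrite softmaxE -expRM mulrC.
apply: is_derive_eq.
rewrite /= scale0r add0r [in RHS]softmaxE -expRM /GRing.scale /=.
by rewrite (mulrC (_ - _) b) mulrCA mulrA.
Qed.

End Softmax.

Lemma partial_AB_loss (R : realType) (C : nat) (alpha beta : R)
    (p f : 'rV[R]_C) (y : 'I_C) :
    alpha != 0 -> beta != 0 -> alpha + beta != 0 ->
  let q := softmax f in
  let g k := q 0 k `^ beta * ((p 0 k `^ alpha - q 0 k `^ alpha) / alpha) in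
  partial (AB_loss alpha beta p) f y = q 0 y * (\sum_k g k) - g y.
Proof.
move=> a0 b0 ab0 q g.
rewrite /partial derive_line.
pose F k (b h : R) := softmax (h *: delta_mx 0 y + f) 0 k `^ b.
have dF k b : is_derive (0 : R) 1 (F k b)
   (b * softmax f 0 k `^ b * ((k == y)%:R - softmax f 0 y)).
  exact: is_derive_softmax_powR.
rewrite (_ : (fun _ => _) = - (1 / (alpha * beta)) \*: \sum_k
    ((p 0 k `^ alpha) \*: F k beta
     - cst (alpha / (alpha + beta) * p 0 k `^ (alpha + beta))
     - (beta / (alpha + beta)) \*: F k (alpha + beta))); last first.
  by apply/funext => h /=; rewrite fct_sumE.
rewrite derive_val.
(* Absorbing the isolated [g y] through an indicator turns the claim into an identity that can be
   checked class by class. *)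
transitivity (\sum_k (q 0 y - (k == y)%:R) * g k); last first.
  rewrite mulr_sumr (bigD1 y) //= [in RHS](bigD1 y) //= eqxx mulrBl mul1r.
  rewrite addrAC; congr (_ + _ - _).
  by apply: eq_bigr => k /negPf ->; rewrite subr0.
rewrite [LHS]mulr_sumr; apply: eq_bigr => k _.
rewrite /g -/q powRD; last by rewrite (negPf ab0).
rewrite /GRing.scale /=; field.
by rewrite a0 b0 ab0.
Qed.

Lemma LogRE (R : realType) (C : nat) (eta : R) (l : 'rV[R]_C -> R)
    (f : 'rV[R]_C) (y : 'I_C) :
  LogR eta l f y = - (eta * partial l f y) +
    (ln (\sum_k expR (f 0 k)) - ln (\sum_k expR (gd_step eta l f 0 k))).
Proof.
rewrite /LogR ln_div ?posrE ?softmax_gt0 // !softmaxE !expRK [gd_step _ _ _ 0 y]mxE.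
ring.
Qed.

(** The class [y] cancels: what remains is the log-ratio of the partition functions before and after
    the step. *)
Lemma normalizationE (R : realType) (C : nat) (eta : R) (l : 'rV[R]_C -> R)
    (f : 'rV[R]_C) (y : 'I_C) :
  normalization eta l f y =
    ln (\sum_k expR (f 0 k)) - ln (\sum_k expR (gd_step eta l f 0 k)).
Proof. by rewrite /normalization LogRE; ring. Qed.

Theorem proposition4p2 (R : realType) (C : nat) (alpha beta eta : R)
    (p f : 'rV[R]_C)
    (alpha_neq0 : alpha != 0) (beta_neq0 : beta != 0)
    (alphaDbeta_neq0 : alpha + beta != 0)
    (p_gt0 : forall k : 'I_C, 0 < p 0 k)
    (p_sum1 : \sum_(k < C) p 0 k = 1)
    (eta_gt0 : 0 < eta) :
  let q := softmax f in
  let l := AB_loss alpha beta p in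
  [/\ forall y : 'I_C,
        `|LogR eta l f y| <=
          eta * q 0 y `^ beta * `|(p 0 y `^ alpha - q 0 y `^ alpha) / alpha|
          + eta * q 0 y *
            (\sum_(k < C) q 0 k `^ beta *
                          `|(p 0 k `^ alpha - q 0 k `^ alpha) / alpha|)
          + `|normalization eta l f y|,
      forall y y' : 'I_C, normalization eta l f y = normalization eta l f y'
    & p = q -> forall y : 'I_C, normalization eta l f y = 0].
Proof.
move=> q l.
have dl y := partial_AB_loss _ _ _ _ p f y alpha_neq0 beta_neq0
  alphaDbeta_neq0.
split=> [y|y y'|pq y]; last first.
- rewrite normalizationE (_ : gd_step eta l f = f) ?subrr //.
  (* With [p = q] every [g k] vanishes, hence so does each partial derivative. *)
  apply/rowP => k; rewrite mxE dl -/q -pq.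
  rewrite big1 => [|j _]; last by rewrite subrr mul0r mulr0.
  by rewrite (subrr (p 0 k `^ alpha)) mul0r !mulr0 subr0 mulr0 subr0.
- by rewrite !normalizationE.
rewrite LogRE -(normalizationE _ _ _ _ _ y).
rewrite (le_trans (ler_normD _ _)) // lerD2r normrN normrM (gtr0_norm eta_gt0).
rewrite -!mulrA -mulrDr ler_pM2l // dl -/q.
(* After cancelling the normalization term and the factor [eta], the two parts of the gradient are
   bounded separately; the weights in front are nonnegative and pass through the absolute value. *)
rewrite (le_trans (ler_normB _ _)) // addrC lerD //.
  by rewrite normrM (ger0_norm (powR_ge0 _ _)).
rewrite normrM (gtr0_norm (softmax_gt0 f y)) ler_pM2l ?softmax_gt0 //.
rewrite (le_trans (ler_norm_sum _ _ _)) //; apply: ler_sum => k _.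
by rewrite normrM (ger0_norm (powR_ge0 _ _)).
Qed.
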